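(* Let $S=\frac{13591409}{545140134}$, $\varepsilon=\frac{1728}{640320^{3}}=53360^{-3}$, and for integers $k\ge 0$ let $$s_k=\frac{(6k)!}{(3k)!\,(k!)^3}\cdot\frac{k+S}{640320^{3k}}.$$ Put $$a_1=\frac{\varepsilon}{2(1+\varepsilon)}=\frac{1}{303862746112002},\qquad a_2=\frac{S\varepsilon}{1+\varepsilon}-\frac{23\varepsilon-4\varepsilon^2}{36(1+\varepsilon)^2}=-\frac{62186213362465}{15388761412454497761254741334}.$$ For every integer $n\ge 1$ define $e_n$ by $$\left|\sum_{k=n}^{\infty}(-1)^k s_k\right|=\frac{s_n}{1+\varepsilon}\left(1+\frac{a_1}{n}+\frac{a_2}{n^2}+\frac{e_n\varepsilon}{n^3}\right).$$ Then $0.3216<e_n<0.6704$ for all $n\ge 1$.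
   Context: $s_k$ are (up to the factor $(-1)^k$) the terms of the Chudnovsky series $\frac{\sqrt{640320^3}}{12\pi}=\sum_{k\ge0}\frac{(-1)^k(6k)!}{(3k)!(k!)^3}\frac{13591409+545140134k}{640320^{3k}}$. *)

(* Defs.v *)
From Stdlib Require Import Reals Factorial.
From Coquelicot Require Import Coquelicot.
Open Scope R_scope.

Definition S0 : R := 13591409 / 545140134.

Definition eps : R := 1728 / 640320 ^ 3.

(* Up to the sign (-1)^k and the factor 545140134, the k-th term of the
   Chudnovsky series for sqrt (640320^3) / (12 * PI). *)
Definition s (k : nat) : R :=
  INR (fact (6 * k)) / (INR (fact (3 * k)) * INR (fact k) ^ 3)
  * ((INR k + S0) / 640320 ^ (3 * k)).

Definition a1 : R := eps / (2 * (1 + eps)).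

Definition a2 : R :=
  S0 * eps / (1 + eps) - (23 * eps - 4 * eps ^ 2) / (36 * (1 + eps) ^ 2).

(* Shifted to start at index 0: the j-th term is the term of index k = n + j. *)
Definition tail_term (n j : nat) : R := (-1) ^ (n + j) * s (n + j).

(* [Series] is total: this is meaningful only once [tail_term n] is summable. *)
Definition is_error_coeff (n : nat) (e : R) : Prop :=
  Rabs (Series (tail_term n)) =
    s n / (1 + eps) *
    (1 + a1 / INR n + a2 / INR n ^ 2 + e * eps / INR n ^ 3).

(* Main.v *)
(** Put [A k = | s k - s (k+1) + s (k+2) - ... |], so that [A k + A (k+1) = s k],
    and [L e k = s k / (1 + eps) * (1 + a1/k + a2/k^2 + e eps/k^3)].  The values
    of [a1] and [a2] are those for which [L e k + L e (k+1)] agrees with [s k] up to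
    [s k * O(eps / k^3)]; for [e = 0.3216] the defect [s k - L e k - L e (k+1)] is
    positive and for [e = 0.6704] it is negative, for every [k >= 1].  Since
    [s (k+1) / s k] is of size [eps], these defects decrease in absolute value, so
    the alternating sum of the defects from [k = n] on, which is [A n - L e n],
    has the sign of its first term. *)

Require Import Defs.
From Stdlib Require Import Reals Factorial Lra Lia Psatz.
From Coquelicot Require Import Coquelicot.
Open Scope R_scope.

(** * The constants and the ratio of consecutive terms *)

Lemma eps_val : eps = / 53360 ^ 3.
Proof. unfold eps; lra. Qed.

Lemma a1_val : a1 = 1 / 303862746112002.
Proof. unfold a1; rewrite eps_val; field. Qed.

Lemma a2_val : a2 = - (62186213362465 / 15388761412454497761254741334).
Proof. unfold a2, S0; rewrite eps_val; field. Qed.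

Lemma eps_pos : 0 < eps.
Proof. rewrite eps_val; lra. Qed.

Lemma eps_small : eps < / 10 ^ 14.
Proof. rewrite eps_val; lra. Qed.

Lemma S0_pos : 0 < S0.
Proof. unfold S0; lra. Qed.

(** This is [s (k+1) / s k] with [k] made real. The even factors of [(6k+6)! / (6k)!] cancel against
    [(3k+3)! / (3k)!] up to 8; the odd ones give 216 times the three linear factors, and 8 * 216 =
    1728. *)
Definition ratio (x : R) : R :=
  eps * (x + / 6) * (x + / 2) * (x + 5 / 6) * (x + 1 + S0)
  / ((x + 1) ^ 3 * (x + S0)).

Definition approx (e x : R) : R := 1 + a1 / x + a2 / x ^ 2 + e * eps / x ^ 3.

(** At [x = k] this is [s k - L e k - L e (k+1)] divided by [s k / (1 + eps)]. *)
Definition defect (e x : R) : R := 1 + eps - approx e x - ratio x * approx e (x + 1).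

Lemma s_pos (k : nat) : 0 < s k.
Proof.
  pose proof S0_pos; pose proof (pos_INR k).
  unfold s; apply Rmult_lt_0_compat; apply Rdiv_lt_0_compat.
  - apply INR_fact_lt_0.
  - apply Rmult_lt_0_compat; [apply INR_fact_lt_0|apply pow_lt, INR_fact_lt_0].
  - lra.
  - apply pow_lt; lra.
Qed.

Lemma s_succ (k : nat) : s (S k) = ratio (INR k) * s k.
Proof.
  pose proof S0_pos; pose proof (pos_INR k).
  unfold s, ratio, eps.
  replace (6 * S k)%nat with (S (S (S (S (S (S (6 * k))))))) by lia.
  replace (3 * S k)%nat with (S (S (S (3 * k)))) by lia.
  rewrite !fact_simpl, !mult_INR, !S_INR, !mult_INR.
  replace (INR 6) with 6 by (simpl; lra).
  replace (INR 3) with 3 by (simpl; lra).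
  rewrite <- !tech_pow_Rmult.
  pose proof (INR_fact_neq_0 k); pose proof (INR_fact_neq_0 (3 * k)).
  assert (640320 ^ (3 * k) <> 0) by (apply pow_nonzero; lra).
  field.
  repeat split; try lra; assumption.
Qed.

Lemma ratio_pos (x : R) : 1 <= x -> 0 < ratio x.
Proof.
  intros Hx; pose proof S0_pos; pose proof eps_pos; unfold ratio.
  apply Rdiv_lt_0_compat; repeat apply Rmult_lt_0_compat; try lra.
Qed.

Lemma ratio_small (x : R) : 1 <= x -> ratio x <= 2 * eps.
Proof.
  intros Hx; pose proof S0_pos; pose proof eps_pos; unfold ratio.
  assert (Hd : 0 < (x + 1) ^ 3 * (x + S0))
    by (apply Rmult_lt_0_compat; [apply pow_lt|]; lra).
  apply Rle_div_l; [exact Hd|].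
  (* The numerator is compared factor by factor: three factors are at most [x + 1], and
     [x + 1 + S0 <= 2 * (x + S0)]. *)
  replace (2 * eps * ((x + 1) ^ 3 * (x + S0)))
    with (eps * (x + 1) * (x + 1) * (x + 1) * (2 * (x + S0))) by ring.
  repeat apply Rmult_le_compat; repeat apply Rmult_le_pos; lra.
Qed.

(** * Two-sided bounds on the defect *)

(* The factor [45000] makes all coefficients of this polynomial in [x] integers for
   the values of the parameters that are used below. *)
Definition scaled_defect (E A B W p q f x : R) : R :=
  72 * W * (625 * (E * x ^ 3 - A * x ^ 2 + B * x) - f * E)
    * (x + 1) ^ 6 * (q * x + p)
  - E * (6 * x + 1) * (2 * x + 1) * (6 * x + 5) * (q * (x + 1) + p)
    * (625 * (W * (x + 1) ^ 3 + A * (x + 1) ^ 2 - B * (x + 1)) + f * E) * x ^ 3.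

Definition scaled_unit (E W p q x : R) : R := W * E * (x + 1) ^ 6 * (q * x + p).

(** Clears all denominators by one positive factor [d]. The parameters stay symbolic so that [field]
    never meets the huge numerals; 625 is the denominator of both 0.3216 and 0.6704. *)
Lemma scaling (E A B W p q x : R) :
  0 < W -> 0 < p -> 0 < q -> 1 <= x ->
  eps = E / W -> a1 = A / W -> a2 = - (B / W) -> S0 = p / q ->
  exists d : R, 0 < d /\
    (forall f, scaled_defect E A B W p q f x = defect (f / 625) x * d) /\
    45000 * scaled_unit E W p q x = eps / x ^ 3 * d.
Proof.
  intros HW Hp Hq Hx HE HA HB HS.
  assert (Hxq : 0 < q * x) by (apply Rmult_lt_0_compat; lra).
  exists (45000 * W ^ 2 * (x ^ 3 * (x + 1) ^ 6 * (q * x + p))); split.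
  - repeat apply Rmult_lt_0_compat; try apply pow_lt; lra.
  - unfold defect, ratio, approx, scaled_defect, scaled_unit.
    rewrite HE, HA, HB, HS.
    split; [intros f|]; field; repeat split; lra.
Qed.

(* In the variable [m = x - 1] both sides are polynomials whose difference has
   nonnegative coefficients. *)
Ltac compare_coeffs x Hx :=
  unfold scaled_defect, scaled_unit;
  assert (Hpow : forall i : nat, 0 <= (x - 1) ^ i)
    by (intros i; apply pow_le; lra);
  set (m := x - 1) in Hpow;
  replace x with (m + 1) by (unfold m; ring);
  pose proof (Hpow 1%nat); pose proof (Hpow 2%nat); pose proof (Hpow 3%nat);
  pose proof (Hpow 4%nat); pose proof (Hpow 5%nat); pose proof (Hpow 6%nat);
  pose proof (Hpow 7%nat);
  clear Hpow; clearbody m; clear x Hx; lra.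

(* The constant [/ 45000] is below the infimum of [x ^ 3 / eps] times the defect,
   which is about [2.9e-5] (at [x = 1]) for [e = 0.3216] and [8.6e-5]
   (as [x -> oo]) for [- defect 0.6704].  The last of the large numbers is a common
   denominator of [eps], [a1] and [a2]; the others are their numerators. *)
Lemma defect_bounds (x : R) : 1 <= x ->
  / 45000 * (eps / x ^ 3) <= defect 0.3216 x <= eps / x ^ 3 /\
  / 45000 * (eps / x ^ 3) <= - defect 0.6704 x <= eps / x ^ 3.
Proof.
  intros Hx.
  set (E := 7694380706227248880627370667).
  set (A := 3847190353113599118418176000).
  set (B := 4724018390656341031371520000).
  set (W := 1169017825512700891995155464132368548352000).
  destruct (scaling E A B W 13591409 545140134 x) as (d & Hd & Hdefect & Hunit);
    unfold E, A, B, W; try lra.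
  { rewrite eps_val; lra. }
  { rewrite a1_val; lra. }
  { rewrite a2_val; lra. }
  { unfold S0; lra. }
  replace 0.3216 with (201 / 625) by lra; replace 0.6704 with (419 / 625) by lra.
  pose proof (Hdefect 201) as Hlow; pose proof (Hdefect 419) as Hup.
  fold E A B W in Hlow, Hup, Hunit.
  set (U := scaled_unit E W 13591409 545140134 x) in *.
  assert (HU : U <= scaled_defect E A B W 13591409 545140134 201 x <= 45000 * U /\
               U <= - scaled_defect E A B W 13591409 545140134 419 x <= 45000 * U).
  { unfold U, E, A, B, W; clear - Hx.
    repeat split; compare_coeffs x Hx. }
  repeat split; apply Rmult_le_reg_r with (1 := Hd); lra.
Qed.

(** The bounds on [f] are only a factor 45000 apart, and [ratio x <= 2 * eps] is far below
    [/ 45000]. *)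
Lemma ratio_mul_lt (f : R -> R) (x : R) :
  (forall y, 1 <= y -> / 45000 * (eps / y ^ 3) <= f y <= eps / y ^ 3) ->
  1 <= x -> ratio x * f (x + 1) < f x.
Proof.
  intros Hf Hx.
  pose proof eps_pos; pose proof eps_small.
  pose proof (ratio_pos x Hx); pose proof (ratio_small x Hx).
  destruct (Hf x Hx) as [Hlow _].
  destruct (Hf (x + 1)) as [_ Hup]; [lra|].
  assert (Hx3 : 0 < x ^ 3) by (apply pow_lt; lra).
  assert (Hmono : / (x + 1) ^ 3 <= / x ^ 3)
    by (apply Rinv_le_contravar; [exact Hx3|apply pow_incr; lra]).
  assert (Hinv : 0 < / x ^ 3) by (apply Rinv_0_lt_compat; exact Hx3).
  apply Rle_lt_trans with (ratio x * (eps * / x ^ 3)).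
  - apply Rmult_le_compat_l; [lra|].
    apply Rle_trans with (1 := Hup), Rmult_le_compat_l; lra.
  - apply Rlt_le_trans with (2 := Hlow).
    apply Rmult_lt_compat_r; [apply Rmult_lt_0_compat; assumption|lra].
Qed.

(** Crude bounds: the upper one makes the error tend to 0, the lower one fixes the sign of the
    alternating tail. *)
Lemma approx_bounds (e x : R) : 0 <= e <= 1 -> 1 <= x -> 0 < approx e x <= 2.
Proof.
  intros He Hx.
  assert (Hy : 0 < / x <= 1).
  { split; [apply Rinv_0_lt_compat; lra|].
    rewrite <- Rinv_1; apply Rinv_le_contravar; lra. }
  replace (approx e x) with (1 + a1 * / x + a2 * (/ x) ^ 2 + e * eps * (/ x) ^ 3)
    by (unfold approx; field; lra).
  set (y := / x) in *; clearbody y.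
  assert (Hpow : forall i, 0 <= y ^ i <= 1).
  { intros i; split; [apply pow_le; lra|].
    rewrite <- (pow1 i); apply pow_incr; lra. }
  pose proof (Hpow 2%nat); pose proof (Hpow 3%nat).
  assert (0 <= e * eps <= / 10).
  { pose proof eps_pos; pose proof eps_small; split; nra. }
  rewrite a1_val, a2_val; split; nra.
Qed.

(** * Geometric decay of the terms and convergence of the tails *)

Lemma INR_ge1 (k : nat) : (1 <= k)%nat -> 1 <= INR k.
Proof. apply (le_INR 1). Qed.

Lemma s_geom_bound (n j : nat) : (1 <= n)%nat -> s (n + j) <= s n * (/ 2) ^ j.
Proof.
  intros Hn; pose proof eps_small.
  induction j as [|j IH].
  - rewrite Nat.add_0_r; simpl; lra.
  - rewrite Nat.add_succ_r, s_succ; simpl.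
    assert (H1 : 1 <= INR (n + j)) by (apply INR_ge1; lia).
    pose proof (ratio_small _ H1); pose proof (s_pos (n + j)).
    apply Rle_trans with (/ 2 * s (n + j)); [apply Rmult_le_compat_r|]; lra.
Qed.

Lemma is_lim_seq_s : is_lim_seq s 0.
Proof.
  (* The geometric bound is available only from index 1 on. *)
  apply (is_lim_seq_incr_n s 1).
  apply is_lim_seq_le_le with (u := fun _ => 0) (w := fun j => s 1 * (/ 2) ^ j).
  - intros j; rewrite (Nat.add_comm j 1); split.
    + apply Rlt_le, s_pos.
    + exact (s_geom_bound 1 j (le_n 1)).
  - apply is_lim_seq_const.
  - replace (Finite 0) with (Rbar_mult (s 1) 0) by (simpl; f_equal; ring).
    apply is_lim_seq_scal_l, is_lim_seq_geom.
    rewrite Rabs_pos_eq; lra.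
Qed.

Lemma Rabs_tail_term (n j : nat) : Rabs (tail_term n j) = s (n + j).
Proof.
  unfold tail_term.
  rewrite Rabs_mult, pow_1_abs, Rmult_1_l.
  apply Rabs_pos_eq, Rlt_le, s_pos.
Qed.

Lemma ex_series_half (c : R) : ex_series (fun j => c * (/ 2) ^ j).
Proof.
  apply (ex_series_scal_l (V := R_NormedModule) c (fun j => (/ 2) ^ j)), ex_series_geom.
  rewrite Rabs_pos_eq; lra.
Qed.

Lemma ex_series_tail (n : nat) : (1 <= n)%nat -> ex_series (tail_term n).
Proof.
  intros Hn.
  apply (ex_series_le (K := R_AbsRing) (V := R_CompleteNormedModule)
           _ (fun j => s n * (/ 2) ^ j)).
  - intros j; change (Rabs (tail_term n j) <= s n * (/ 2) ^ j).
    rewrite Rabs_tail_term; apply s_geom_bound, Hn.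
  - apply ex_series_half.
Qed.

Lemma Rabs_Series_tail (n : nat) : (1 <= n)%nat ->
  Rabs (Series (tail_term n)) <= 2 * s n.
Proof.
  intros Hn.
  assert (Hbound : forall j, 0 <= Rabs (tail_term n j) <= s n * (/ 2) ^ j).
  { intros j; split; [apply Rabs_pos|].
    rewrite Rabs_tail_term; apply s_geom_bound, Hn. }
  apply Rle_trans with (Series (fun j => Rabs (tail_term n j))).
  - apply Series_Rabs.
    apply (ex_series_le (K := R_AbsRing) (V := R_CompleteNormedModule)
             _ (fun j => s n * (/ 2) ^ j)).
    + intros j; change (Rabs (Rabs (tail_term n j)) <= s n * (/ 2) ^ j).
      rewrite Rabs_Rabsolu; apply Hbound.
    + apply ex_series_half.
  - apply Rle_trans with (Series (fun j => s n * (/ 2) ^ j)).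
    + apply Series_le; [exact Hbound|apply ex_series_half].
    + rewrite Series_scal_l, Series_geom by (rewrite Rabs_pos_eq; lra).
      lra.
Qed.

(** * The sign of the error *)

Definition alt_tail (n : nat) : R := (-1) ^ n * Series (tail_term n).

Lemma Rabs_alt_tail (n : nat) : Rabs (alt_tail n) = Rabs (Series (tail_term n)).
Proof. unfold alt_tail; rewrite Rabs_mult, pow_1_abs; ring. Qed.

Lemma alt_tail_succ (n : nat) : (1 <= n)%nat -> alt_tail n + alt_tail (S n) = s n.
Proof.
  intros Hn; unfold alt_tail.
  rewrite Series_incr_1 by (apply ex_series_tail, Hn).
  rewrite (Series_ext (fun k => tail_term n (S k)) (tail_term (S n)))
    by (intros j; unfold tail_term; now rewrite Nat.add_succ_r).
  unfold tail_term at 1; rewrite Nat.add_0_r, <- tech_pow_Rmult.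
  assert (Hsq : (-1) ^ n * (-1) ^ n = 1)
    by (rewrite <- Rpow_mult_distr; replace (-1 * -1) with 1 by ring; apply pow1).
  transitivity ((-1) ^ n * (-1) ^ n * s n); [ring|rewrite Hsq; ring].
Qed.

(** Along [n + 2, n + 4, ...] the sequence decreases to 0, so [D (n+2) >= 0]; the strict first step
    gives [D n > 0]. *)
Lemma pos_of_step2_decr (D : nat -> R) (n : nat) :
  (forall k, (n <= k)%nat -> D (S (S k)) < D k) -> is_lim_seq D 0 -> 0 < D n.
Proof.
  intros Hdecr Hlim.
  assert (Hle : forall m, D (n + 2 + 2 * m)%nat <= D (n + 2)%nat).
  { induction m as [|m IH].
    - replace (n + 2 + 2 * 0)%nat with (n + 2)%nat by lia; lra.
    - replace (n + 2 + 2 * S m)%nat with (S (S (n + 2 + 2 * m))) by lia.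
      apply Rle_trans with (2 := IH), Rlt_le, Hdecr; lia. }
  assert (H0 : Rbar_le 0 (D (n + 2)%nat)).
  { apply is_lim_seq_le with (u := fun m => D (n + 2 + 2 * m)%nat)
                             (v := fun _ => D (n + 2)%nat).
    - exact Hle.
    - apply is_lim_seq_subseq with (2 := Hlim).
      apply eventually_subseq; intros m; lia.
    - apply is_lim_seq_const. }
  specialize (Hdecr n (le_n n)).
  replace (n + 2)%nat with (S (S n)) in H0 by lia.
  simpl in H0; lra.
Qed.

Definition error (e : R) (k : nat) : R :=
  alt_tail k - s k / (1 + eps) * approx e (INR k).

(** The sum [error e k + error e (k+1)] is [s k / (1 + eps)] times the defect at [k]; subtracting
    the same identity at [k + 1] pairs two terms of the alternating sum. *)
Lemma error_step2 (e : R) (k : nat) : (1 <= k)%nat ->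
  error e k - error e (S (S k)) =
    s k / (1 + eps)
    * (defect e (INR k) - ratio (INR k) * defect e (INR k + 1)).
Proof.
  intros Hk; pose proof eps_pos.
  pose proof (alt_tail_succ k Hk) as H1.
  pose proof (alt_tail_succ (S k) ltac:(lia)) as H2.
  unfold error, defect.
  replace (alt_tail k) with (s k - s (S k) + alt_tail (S (S k))) by lra.
  rewrite (s_succ (S k)), (s_succ k), !S_INR.
  field; lra.
Qed.

Lemma is_lim_seq_error (e : R) : 0 <= e <= 1 -> is_lim_seq (error e) 0.
Proof.
  intros He.
  apply is_lim_seq_abs_0, (is_lim_seq_incr_n _ 1).
  (* The tail and its approximation are each at most [2 * s k] in absolute value. *)
  apply is_lim_seq_le_le with (u := fun _ => 0) (w := fun j => 4 * s (j + 1)).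
  - intros j; split; [apply Rabs_pos|].
    set (k := (j + 1)%nat).
    assert (Hk : (1 <= k)%nat) by (unfold k; lia).
    pose proof (approx_bounds e (INR k) He (INR_ge1 k Hk)).
    pose proof (Rabs_Series_tail k Hk) as Ht; rewrite <- Rabs_alt_tail in Ht.
    pose proof (s_pos k); pose proof eps_pos.
    assert (Hs : 0 < s k / (1 + eps) <= s k).
    { split; [apply Rdiv_lt_0_compat; lra|].
      apply Rle_div_l; nra. }
    unfold error.
    apply Rabs_le_between in Ht; apply Rabs_le_between.
    nra.
  - apply is_lim_seq_const.
  - replace (Finite 0) with (Rbar_mult 4 0) by (simpl; f_equal; ring).
    apply is_lim_seq_scal_l, (is_lim_seq_incr_n s 1), is_lim_seq_s.
Qed.

Lemma error_lower (n : nat) : (1 <= n)%nat -> 0 < error 0.3216 n.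
Proof.
  intros Hn; apply pos_of_step2_decr; [|apply is_lim_seq_error; lra].
  intros k Hk.
  apply Rlt_0_minus; rewrite error_step2 by lia.
  pose proof (s_pos k); pose proof eps_pos.
  apply Rmult_lt_0_compat; [apply Rdiv_lt_0_compat; lra|].
  apply Rlt_0_minus, ratio_mul_lt; [apply defect_bounds|apply INR_ge1; lia].
Qed.

Lemma error_upper (n : nat) : (1 <= n)%nat -> error 0.6704 n < 0.
Proof.
  intros Hn; apply Ropp_lt_cancel; rewrite Ropp_0.
  apply (pos_of_step2_decr (fun k => - error 0.6704 k)).
  - intros k Hk.
    apply Ropp_lt_contravar, Rlt_0_minus.
    rewrite <- Ropp_minus_distr, error_step2, Ropp_mult_distr_r by lia.
    pose proof (s_pos k); pose proof eps_pos.
    apply Rmult_lt_0_compat; [apply Rdiv_lt_0_compat; lra|].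
    pose proof (ratio_mul_lt (fun x => - defect 0.6704 x) (INR k)
                  (fun y Hy => proj2 (defect_bounds y Hy)) (INR_ge1 k ltac:(lia))).
    simpl in *; lra.
  - replace (Finite 0) with (Rbar_opp 0) by (simpl; f_equal; ring).
    apply -> is_lim_seq_opp; apply is_lim_seq_error; lra.
Qed.

Theorem theorem1 :
  eps = / 53360 ^ 3 /\
  a1 = 1 / 303862746112002 /\
  a2 = - (62186213362465 / 15388761412454497761254741334) /\
  forall n : nat, (1 <= n)%nat ->
    ex_series (tail_term n) /\
    (exists! e : R, is_error_coeff n e) /\
    (forall e : R, is_error_coeff n e -> 0.3216 < e < 0.6704).
Proof.
  split; [exact eps_val|split; [exact a1_val|split; [exact a2_val|]]].
  intros n Hn; split; [exact (ex_series_tail n Hn)|].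
  pose proof (INR_ge1 n Hn) as Hn1.
  pose proof (s_pos n); pose proof eps_pos.
  assert (Hc : 0 < s n / (1 + eps)) by (apply Rdiv_lt_0_compat; lra).
  assert (Hn3 : 0 < INR n ^ 3) by (apply pow_lt; lra).
  assert (Hslope : 0 < s n / (1 + eps) * (eps / INR n ^ 3))
    by (apply Rmult_lt_0_compat; [|apply Rdiv_lt_0_compat]; assumption).
  (* The approximation is affine in [e] with positive slope, so the coefficient exists, is unique,
     and is located by the signs of the two errors. *)
  assert (Haffine : forall e, s n / (1 + eps) * approx e (INR n) =
            s n / (1 + eps) * approx 0 (INR n)
            + s n / (1 + eps) * (eps / INR n ^ 3) * e)
    by (intros e; unfold approx; field; lra).
  pose proof (error_lower n Hn) as Hlow; pose proof (error_upper n Hn) as Hup.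
  unfold error in Hlow, Hup.
  (* As [error 0.3216 n > 0], the alternating tail exceeds this positive quantity, which removes the
     absolute value. *)
  assert (Hpos : 0 < s n / (1 + eps) * approx 0.3216 (INR n)).
  { apply Rmult_lt_0_compat; [exact Hc|].
    apply approx_bounds; lra. }
  assert (Habs : Rabs (Series (tail_term n)) = alt_tail n)
    by (rewrite <- Rabs_alt_tail; apply Rabs_pos_eq; lra).
  assert (Hiff : forall e, is_error_coeff n e <->
            alt_tail n = s n / (1 + eps) * approx e (INR n))
    by (intros e; unfold is_error_coeff, approx; rewrite Habs; reflexivity).
  rewrite Haffine in Hlow, Hup.
  set (c := s n / (1 + eps) * approx 0 (INR n)) in *.
  set (b := s n / (1 + eps) * (eps / INR n ^ 3)) in *.
  split.
  - exists ((alt_tail n - c) / b); split.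
    + apply Hiff; rewrite Haffine; field; lra.
    + intros e He; apply Hiff in He; rewrite He, Haffine; field; lra.
  - intros e He; apply Hiff in He; rewrite Haffine in He.
    split; apply Rmult_lt_reg_l with (1 := Hslope); lra.
Qed.
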